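(* It holds that $$\|X_\sigma(t)-X_\sigma(s)\|_{\mathcal W}\le|t-s|,\qquad t,s\in\mathbb R.$$ Moreover the function $t\mapsto X_\sigma(t)$ is differentiable in $\mathcal W$ (i.e. as a function from $\mathbb R$ to $\mathcal W$, in the norm of $\mathcal W$), and its derivative is given by $$W_\sigma(t)=\sum_{n=0}^\infty\widehat\sigma(t-\lambda_n)Z_n.$$
   Context: $\sigma$ is a Borel probability measure on $\mathbb R$, symmetric under $u\mapsto-u$, supported in $[-1/2,1/2]$, and there are distinct numbers $\lambda_0=0,\lambda_1,\lambda_2,\ldots$ in $\pi\mathbb N_0$ such that the functions $e_{\lambda_n}(u)=e^{i\lambda_n u}$, $n\ge0$, form an orthonormal basis of $\mathbf L_2(d\sigma)$. Its Fourier transform is $\widehat\sigma(t)=\int_{\mathbb R}e^{itu}\,d\sigma(u)$. White noise space: let $\mathcal S$ be the real Schwartz space on $\mathbb R$, $\Omega=\mathcal S'$ with its Borel $\sigma$-algebra, $P$ the probability measure on $\Omega$ with $\int_\Omega e^{-i\langle\omega,s\rangle}dP(\omega)=e^{-\|s\|^2_{\mathbf L_2(\mathbb R,dx)}/2}$ for $s\in\mathcal S$, and $\mathcal W=\mathbf L_2(\Omega,P)$. The map $s\mapsto\widetilde s$, $\widetilde s(\omega)=\langle\omega,s\rangle$, extends to an isometry $f\mapsto\widetilde f$ from real $\mathbf L_2(\mathbb R,dx)$ into $\mathcal W$. With $h_0,h_1,\ldots$ the Hermite functions (orthonormal basis of $\mathbf L_2(\mathbb R,dx)$), $Z_n=\widetilde{h_n}$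 are i.i.d. $\mathcal N(0,1)$ random variables. The process is $$X_\sigma(t)=\widetilde{Q_\sigma(1_{[0,t]})}=\sum_{n=0}^\infty\Bigl(\int_0^t\widehat\sigma(y-\lambda_n)\,dy\Bigr)Z_n,\quad t\in\mathbb R,$$ where $Q_\sigma(1_{[0,t]})=\sum_{n\ge0}\bigl(\int_0^t\widehat\sigma(y-\lambda_n)dy\bigr)h_n\in\mathbf L_2(\mathbb R,dx)$. *)

(* Defs.v *)
From HB Require Import structures.
From mathcomp Require Import all_boot all_order all_algebra.
From mathcomp Require Import complex.
From mathcomp Require Import all_classical all_reals all_analysis.
From mathcomp Require Import measurable_realfun.

Set Implicit Arguments.
Unset Strict Implicit.
Unset Printing Implicit Defensive.

Import Order.TTheory GRing.Theory Num.Theory.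
Import numFieldTopology.Exports numFieldNormedType.Exports.

Local Open Scope classical_set_scope.
Local Open Scope ring_scope.
Local Open Scope complex_scope.

Definition L2norm d (T : measurableType d) (R : realType)
    (mu : {measure set T -> \bar R}) (f : T -> R) : \bar R :=
  ('N[mu]_2%:E[EFin \o f])%E.

Definition cexpi (R : realType) (x : R) : R[i] := cos x +i* sin x.

Definition cintegral d (T : measurableType d) (R : realType)
    (mu : {measure set T -> \bar R}) (f : T -> R[i]) : R[i] :=
  (\int[mu]_x complex.Re (f x)) +i* (\int[mu]_x complex.Im (f x)).

Definition cLfun2 d (T : measurableType d) (R : realType)
    (mu : {measure set T -> \bar R}) (f : T -> R[i]) : Prop :=
  (fun x => complex.Re (f x)) \in Lfun mu 2%:E /\
  (fun x => complex.Im (f x)) \in Lfun mu 2%:E.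

Definition cdot d (T : measurableType d) (R : realType)
    (mu : {measure set T -> \bar R}) (f g : T -> R[i]) : R[i] :=
  cintegral mu (fun x => f x * conjc (g x)).

Definition cL2norm d (T : measurableType d) (R : realType)
    (mu : {measure set T -> \bar R}) (f : T -> R[i]) : \bar R :=
  L2norm mu (fun x => ComplexField.Normc.normc (f x)).

Definition orthonormal_basis d (T : measurableType d) (R : realType)
    (mu : {measure set T -> \bar R}) (e : nat -> T -> R[i]) : Prop :=
  [/\ forall n, cLfun2 mu (e n),
      forall m n, cdot mu (e m) (e n) = (m == n)%:R
    & forall f, cLfun2 mu f ->
        cL2norm mu (fun x => f x - \sum_(k < n) cdot mu f (e k) * e k x)
          @[n --> \oo] --> 0%E].

(* Elements of real [L_2] are handled through representatives, i.e. functions in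
   [Lfun mu 2]; [LspaceType] carries no vector space structure. *)

Definition L2_cvg d (T : measurableType d) (R : realType)
    (mu : {measure set T -> \bar R}) (u : nat -> T -> R) (f : T -> R) : Prop :=
  [/\ forall n, u n \in Lfun mu 2%:E,
      f \in Lfun mu 2%:E
    & L2norm mu (u n \- f) @[n --> \oo] --> 0%E].

Definition partial_sum (T : Type) (R : realType) (u : nat -> T -> R)
    (n : nat) : T -> R := fun x => \sum_(k < n) u k x.

(* A representative of the sum of the series; the default value [0] is only
   used for a series that does not converge in [L_2]. *)
Definition L2_sum d (T : measurableType d) (R : realType)
    (mu : {measure set T -> \bar R}) (u : nat -> T -> R) : T -> R :=
  xget (cst 0) [set f | L2_cvg mu (partial_sum u) f].

Definition L2_is_derive d (T : measurableType d) (R : realType)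
    (mu : {measure set T -> \bar R}) (X : R -> T -> R) (t : R)
    (D : T -> R) : Prop :=
  [/\ forall s, X s \in Lfun mu 2%:E,
      D \in Lfun mu 2%:E
    & L2norm mu (fun w => h^-1 * (X (h + t) w - X t w) - D w)
        @[h --> 0^'] --> 0%E].

Definition is_schwartz (R : realType) : {pred R -> R} :=
  fun f => `[< (forall n x, derivable (derive1n n f) x 1) /\
    (forall m n, exists C, forall x, `|x ^+ m * derive1n n f x| <= C) >].

Section schwartz_submod.
Context {R : realType}.
Implicit Types f g : R -> R.

Let smooth f := forall n x, derivable (derive1n n f) x 1.

Lemma derive1nD_smooth f g a : smooth f -> smooth g ->
  forall n, derive1n n (a *: f + g) = a *: derive1n n f + derive1n n g.
Proof.
move=> sf sg; elim=> [|n IH]; first by rewrite !derive1n0.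
rewrite !derive1nS IH; apply/funext => x.
have df : derivable (a *: derive1n n f) x 1 by apply: derivableZ; exact: sf.
have dg : derivable (derive1n n g) x 1 by exact: sg.
by rewrite derive1E deriveD// deriveZ ?fctE ?derive1E//; exact: sf.
Qed.

Lemma is_schwartz_submod : submod_closed (@is_schwartz R).
Proof.
have h0 n : derive1n n (0 : R -> R) = 0.
  elim: n => [|n IH]; first by rewrite /derive1n/=.
  rewrite derive1nS IH; apply/funext => x.
  by rewrite derive1E (_ : 0 = cst 0 :> (R -> R))// derive_cst.
split.
  rewrite unfold_in; apply/asboolP; split=> [n x|m n].
    by rewrite h0; exact: derivable_cst.
  by exists 0 => x; rewrite h0 [X in `|X|]mulr0 normr0.
move=> a f g; rewrite !unfold_in => /asboolP[sf bf] /asboolP[sg bg].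
apply/asboolP; split=> [n x|m n].
  rewrite derive1nD_smooth//; apply: derivableD; last exact: sg.
  by apply: derivableZ; exact: sf.
have [Cf hf] := bf m n; have [Cg hg] := bg m n.
exists (`|a| * Cf + Cg) => x; rewrite derive1nD_smooth//.
have -> : x ^+ m * (a *: derive1n n f + derive1n n g) x =
    a * (x ^+ m * derive1n n f x) + x ^+ m * derive1n n g x.
  by rewrite mulrCA -mulrDr.
by rewrite (le_trans (ler_normD _ _))// lerD// normrM ler_wpM2l.
Qed.

HB.instance Definition _ :=
  GRing.isSubmodClosed.Build R (R -> R) (@is_schwartz R) is_schwartz_submod.

End schwartz_submod.

Record schwartz (R : realType) := Schwartz {
  schwartz_fun :> R -> R;
  schwartzP : schwartz_fun \in @is_schwartz R }.

Section schwartz_space.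
Context (R : realType).

HB.instance Definition _ := [isSub for @schwartz_fun R].
HB.instance Definition _ := [Choice of schwartz R by <:].
HB.instance Definition _ := [SubChoice_isSubLmodule of schwartz R by <:].

(* The Frechet topology of the seminorms [sup_x |x^m f^(n)(x)|]: the initial
   topology for the maps [f |-> x^m f^(n)] with values in the functions with
   the topology of uniform convergence. *)
Definition schwartz_jets (f : schwartz R) :
    prod_topology (fun _ : nat * nat => {uniform R -> R}) :=
  fun mn => (fun x : R => x ^+ mn.1 * derive1n mn.2 f x).

HB.instance Definition _ :=
  Topological.copy (schwartz R) (initial_topology schwartz_jets).

End schwartz_space.

Record tempered (R : realType) := Tempered {
  tempered_fun :> schwartz R -> R;
  tempered_linear : linear (tempered_fun : schwartz R -> R^o);
  tempered_continuous : continuous tempered_fun }.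

Section tempered_space.
Context (R : realType).

Lemma tempered0_linear : linear ((fun=> 0) : schwartz R -> R^o).
Proof. by move=> a f g; rewrite scaler0 addr0. Qed.

Lemma tempered0_continuous : continuous ((fun=> 0) : schwartz R -> R).
Proof. by move=> x; apply: cvg_cst; exact: nbhs_filter. Qed.

Definition tempered0 : tempered R :=
  Tempered tempered0_linear tempered0_continuous.

HB.instance Definition _ := gen_eqMixin (tempered R).
HB.instance Definition _ := gen_choiceMixin (tempered R).
HB.instance Definition _ := isPointed.Build (tempered R) tempered0.

Definition tempered_eval (w : tempered R) : {ptws schwartz R -> R} := w.

(* The weak-* topology; its Borel sigma-algebra is also that of the strong
   topology. *)
HB.instance Definition _ :=
  Topological.copy (tempered R) (initial_topology tempered_eval).

End tempered_space.

Definition Omega (R : realType) := g_sigma_algebraType (@open (tempered R)).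

Definition pairing (R : realType) (w : Omega R) (s : schwartz R) : R :=
  tempered_fun w s.

Definition white_noise_law (R : realType) (P : probability (Omega R) R) : Prop :=
  forall s : schwartz R,
    cintegral P (fun w => cexpi (- pairing w s)) =
    (expR (- (fine (L2norm lebesgue_measure s)) ^+ 2 / 2))%:C.

(* [tilde] is (on representatives) the linear isometry of real [L_2(R, dx)]
   into [L_2(Omega, P)] that extends [s |-> <., s>]. *)
Definition white_noise_isometry (R : realType) (P : probability (Omega R) R)
    (tilde : (R -> R) -> (Omega R -> R)) : Prop :=
  [/\ forall f, f \in Lfun lebesgue_measure 2%:E -> tilde f \in Lfun P 2%:E,
      forall (a : R) f g, f \in Lfun lebesgue_measure 2%:E ->
        g \in Lfun lebesgue_measure 2%:E ->
        {ae P, forall w, tilde (a *: f + g) w = a * tilde f w + tilde g w},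
      forall f, f \in Lfun lebesgue_measure 2%:E ->
        L2norm P (tilde f) = L2norm lebesgue_measure f
    & forall s : schwartz R,
        {ae P, forall w, tilde s w = pairing w s}].

(* The orthonormal Hermite functions, by Rodrigues' formula. *)
Definition hermite (R : realType) (n : nat) (x : R) : R :=
  (-1) ^+ n / Num.sqrt (2 ^+ n * n`!%:R * Num.sqrt pi) *
  expR (x ^+ 2 / 2) * derive1n n (fun y : R => expR (- y ^+ 2)) x.

Definition symmetric_measure (R : realType)
    (sigma : probability (measurableTypeR R) R) : Prop :=
  forall A : set R, measurable A -> sigma (-%R @^-1` A) = sigma A.

Definition fourier (R : realType) (sigma : probability (measurableTypeR R) R)
    (t : R) : R[i] :=
  cintegral sigma (fun u => cexpi (t * u)).

(* The real-valued version of [fourier], for use in real [L_2] spaces; it agrees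
   with [fourier] for symmetric measures, see [fourier_real]. *)
Definition fourierR (R : realType) (sigma : probability (measurableTypeR R) R)
    (t : R) : R := complex.Re (fourier sigma t).

Lemma fourier_real (R : realType) (sigma : probability (measurableTypeR R) R)
    (t : R) : symmetric_measure sigma -> fourier sigma t = (fourierR sigma t)%:C.
Proof.
move=> sym; rewrite /fourierR /fourier /cintegral /=; congr (_ +i* _).
have mN : measurable_fun [set: measurableTypeR R]
    (-%R : measurableTypeR R -> measurableTypeR R).
  exact: oppr_measurable.
pose f (u : measurableTypeR R) := (sin (t * u))%:E.
have mf : measurable_fun [set: measurableTypeR R] (fun u : R => sin (t * u)).
  apply: continuous_measurable_fun => x.
  apply: continuous_comp; last exact: continuous_sin.
  by apply: cvgM; [exact: cvg_cst|exact: cvg_id].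
have intf : sigma.-integrable setT f.
  apply: (@measurable_bounded_integrable _ _ _ sigma (fun u => sin (t * u))) => //.
    by rewrite (le_lt_trans (probability_le1 _ _))// ltry.
  exists 1; split=> [|M M1 x _ /=]; first exact: real1.
  by rewrite (le_trans _ (ltW M1))// ler_norml sin_geN1 sin_le1.
have fN : f \o -%R = (fun u => - f u)%E.
  by apply/funext => u; rewrite /f/= mulrN sinN EFinN.
have intfN : sigma.-integrable (-%R @^-1` [set: measurableTypeR R]) (f \o -%R).
  by rewrite fN preimage_setT; exact: integrableN.
have E : (\int[sigma]_u f u = - \int[sigma]_u f u)%E.
  rewrite -[in RHS]integralN; last exact: integrable_add_def.
  have mf' : measurable_fun setT f by exact/measurable_EFinP.
  have := integral_pushforward mN mf' intfN measurableT.
  rewrite fN preimage_setT => <-.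
  pose nu := measure_function_pushforward__canonical__measure_function_Measure
    sigma mN.
  by apply: (@eq_measure_integral _ _ _ _ nu) => A mA _; exact/esym/sym.
rewrite /Rintegral -/f.
have := integrable_fin_num measurableT intf.
move: E; rewrite /f; case: (\int[_]_(_ in _) _)%E => //= r [/eqP].
by rewrite -addr_eq0 -mulr2n mulrn_eq0/= => /eqP.
Qed.

(* The oriented integral: [- \int_b^a f] when [b < a]. *)
Definition oriented_integral (R : realType) (a b : R) (f : R -> R) : R :=
  if a <= b then \int[lebesgue_measure]_(y in `[a, b]) f y
  else - \int[lebesgue_measure]_(y in `[b, a]) f y.

Definition Qcoef (R : realType) (sigma : probability (measurableTypeR R) R)
    (lambda : nat -> R) (t : R) (n : nat) : R :=
  oriented_integral 0 t (fun y => fourierR sigma (y - lambda n)).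

Definition Qsigma1 (R : realType) (sigma : probability (measurableTypeR R) R)
    (lambda : nat -> R) (t : R) : R -> R :=
  L2_sum lebesgue_measure (fun n x => Qcoef sigma lambda t n * hermite n x).

Definition Xsigma (R : realType) (sigma : probability (measurableTypeR R) R)
    (lambda : nat -> R) (tilde : (R -> R) -> (Omega R -> R)) (t : R) :
    Omega R -> R :=
  tilde (Qsigma1 sigma lambda t).

Definition Wterm (R : realType) (sigma : probability (measurableTypeR R) R)
    (lambda : nat -> R) (tilde : (R -> R) -> (Omega R -> R)) (t : R)
    (n : nat) : Omega R -> R :=
  fun w => fourierR sigma (t - lambda n) * tilde (@hermite R n) w.

Definition Wsigma (R : realType) (P : probability (Omega R) R)
    (sigma : probability (measurableTypeR R) R) (lambda : nat -> R)
    (tilde : (R -> R) -> (Omega R -> R)) (t : R) : Omega R -> R :=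
  L2_sum P (Wterm sigma lambda tilde t).

(* Main.v *)
Require Import Defs.
From mathcomp Require Import all_boot all_order all_algebra.
From mathcomp Require Import complex ring lra.
From mathcomp Require Import all_classical all_reals all_analysis.
From mathcomp Require Import measurable_realfun.

(** The Fourier transform of [sigma] enters only through the numbers
    [a_n(t) = fourierR sigma (t - lambda n)]. They are the coefficients, along the
    orthonormal exponentials [e_(lambda n)], of the exponential [e_t] in
    [L_2(sigma)], so Bessel's inequality gives
    - [\sum_n a_n(t) ^ 2 <= ||e_t|| ^ 2 = 1], and
    - [\sum_n (a_n(t) - a_n(s)) ^ 2 <= ||e_t - e_s|| ^ 2 <= (t - s) ^ 2],
    the last bound because [sigma] lives on [[-1/2, 1/2]]. In other words
    [t |-> (a_n(t))_n] is a curve in the unit ball of [l_2] that is Lipschitz with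
    constant 1 ([sum_sqr_fourierR], [sum_sqr_fourierRB]).

    The coefficients [Qcoef t n] of [Q_sigma(1_[0, t])] are primitives of the [a_n].
    The mean value inequality in [l_2], proved for finite sections by
    applying the scalar mean value theorem to a linear functional
    ([sum_sqr_mean_value]), then bounds the increments of the curve
    [t |-> (Qcoef t n)_n] by [|t - s|], and its distance to its tangent line at [s]
    with slope [(a_n(s))_n] by [(t - s) ^ 2]. Thus this curve is Lipschitz with
    constant 1 and differentiable in [l_2], with derivative [(a_n(t))_n].

    It remains to carry these facts from [l_2] to [L_2(Omega, P)]. The
    map [(b_n) |-> \sum_n b_n h_n] is isometric since the Hermite functions are
    orthonormal ([hermite_orthonormal]) and [L_2] is complete ([L2_complete]);
    [tilde] is isometric by hypothesis. *)

Set Implicit Arguments.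
Unset Strict Implicit.
Unset Printing Implicit Defensive.

Import Order.TTheory GRing.Theory Num.Theory.
Import numFieldTopology.Exports numFieldNormedType.Exports.

Local Open Scope classical_set_scope.
Local Open Scope ring_scope.

(** * Inner product and orthonormal systems in real L_2 *)

Section L2_inner_product.
Context d (T : measurableType d) (R : realType).
Variable mu : {measure set T -> \bar R}.
Implicit Types f g h : T -> R.

Definition ip f g : R := \int[mu]_x (f x * g x).

Lemma Lfun_measurable f p : f \in Lfun mu p -> measurable_fun setT f.
Proof. by move=> /andP[]; rewrite inE. Qed.

Lemma integrable_ip f g : f \in Lfun mu 2%:E -> g \in Lfun mu 2%:E ->
  mu.-integrable setT (EFin \o (fun x => f x * g x)).
Proof. by move=> lf lg; apply/Lfun1_integrable/Lfun2_mul_Lfun1. Qed.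

Lemma ipC f g : ip f g = ip g f.
Proof. by apply: eq_Rintegral => x _; rewrite mulrC. Qed.

Lemma ip_ge0 f : 0 <= ip f f.
Proof. by apply: Rintegral_ge0 => x _; rewrite -expr2 sqr_ge0. Qed.

Let L2le1 : (1 <= 2%:E :> \bar R)%E. Proof. exact: lee1n. Qed.

Lemma Lfun2D f g : f \in Lfun mu 2%:E -> g \in Lfun mu 2%:E ->
  f + g \in Lfun mu 2%:E.
Proof.
by move=> lf lg; have := Lfun_submod_closed mu L2le1 => -[_ /(_ 1 f g lf lg)];
  rewrite scale1r.
Qed.

Lemma Lfun2Z a f : f \in Lfun mu 2%:E -> a *: f \in Lfun mu 2%:E.
Proof.
move=> lf; have := Lfun_submod_closed mu L2le1 => -[l0 /(_ a f 0 lf)].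
by rewrite addr0; exact.
Qed.

Lemma Lfun2B f g : f \in Lfun mu 2%:E -> g \in Lfun mu 2%:E ->
  f - g \in Lfun mu 2%:E.
Proof. by move=> lf lg; rewrite -scaleN1r Lfun2D// Lfun2Z. Qed.

Lemma Lfun2_sum (n : nat) (u : nat -> T -> R) :
  (forall k, u k \in Lfun mu 2%:E) -> \sum_(k < n) u k \in Lfun mu 2%:E.
Proof.
move=> lu; elim: n => [|n IH]; last by rewrite big_ord_recr Lfun2D.
by rewrite big_ord0; have [] := Lfun_submod_closed mu L2le1.
Qed.

Lemma Lfun2_combo (n : nat) (b : nat -> R) (u : nat -> T -> R) :
  (forall k, u k \in Lfun mu 2%:E) ->
  \sum_(k < n) b k *: u k \in Lfun mu 2%:E.
Proof.
by move=> lu; apply: (@Lfun2_sum n (fun k => b k *: u k)) => k; exact: Lfun2Z.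
Qed.

Lemma ipDl f g h : f \in Lfun mu 2%:E -> g \in Lfun mu 2%:E ->
  h \in Lfun mu 2%:E -> ip (f + g) h = ip f h + ip g h.
Proof.
move=> lf lg lh; rewrite /ip -RintegralD//; [|exact: integrable_ip..].
by apply: eq_Rintegral => x _; rewrite mulrDl.
Qed.

Lemma ipZl a f h : f \in Lfun mu 2%:E ->
  h \in Lfun mu 2%:E -> ip (a *: f) h = a * ip f h.
Proof.
move=> lf lh; rewrite /ip -RintegralZl//; last exact: integrable_ip.
by apply: eq_Rintegral => x _; rewrite mulrA.
Qed.

Lemma ip_suml (n : nat) (b : nat -> R) (u : nat -> T -> R) h :
  (forall k, u k \in Lfun mu 2%:E) -> h \in Lfun mu 2%:E ->
  ip (\sum_(k < n) b k *: u k) h = \sum_(k < n) b k * ip (u k) h.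
Proof.
move=> lu lh; elim: n => [|n IH].
  rewrite !big_ord0 /ip; under eq_Rintegral do rewrite mul0r.
  by rewrite Rintegral_cst// mul0r.
rewrite !big_ord_recr/= ipDl ?IH ?ipZl//; last exact: Lfun2Z.
exact: Lfun2_combo.
Qed.

Lemma L2norm_ip f : f \in Lfun mu 2%:E ->
  L2norm mu f = (Num.sqrt (ip f f))%:E.
Proof.
move=> lf; rewrite /L2norm unlock.
have -> : (\int[mu]_x (`|(EFin \o f) x| `^ 2) = (ip f f)%:E)%E.
  rewrite /ip /Rintegral fineK; last first.
    by apply: integrable_fin_num => //; exact: integrable_ip.
  by apply: eq_integral => x _ /=;
    rewrite powR_mulrn// -normrX ger0_norm ?sqr_ge0// expr2.
by rewrite poweR_EFin powR12_sqrt// ip_ge0.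
Qed.

Definition orthonormal (e : nat -> T -> R) :=
  (forall n, e n \in Lfun mu 2%:E) /\ forall m n, ip (e m) (e n) = (m == n)%:R.

Lemma ip_combo_orthonormal (e : nat -> T -> R) (b : nat -> R) n k :
  orthonormal e ->
  ip (\sum_(j < n) b j *: e j) (e k) = if (k < n)%N then b k else 0.
Proof.
move=> [le oe]; rewrite ip_suml//; under eq_bigr do rewrite oe.
case: ltnP => kn.
  rewrite (bigD1 (Ordinal kn))//= eqxx mulr1 big1 ?addr0// => i ik.
  by rewrite (_ : (i == k :> nat) = false) ?mulr0//; apply: contraNF ik.
by rewrite big1// => i _; rewrite ltn_eqF ?mulr0// (leq_trans (ltn_ord i)).
Qed.

Lemma pythagoras (e : nat -> T -> R) (b : nat -> R) n : orthonormal e ->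
  ip (\sum_(k < n) b k *: e k) (\sum_(k < n) b k *: e k) =
  \sum_(k < n) b k ^+ 2.
Proof.
move=> oe; rewrite ip_suml; [|by case: oe|by apply: Lfun2_combo; case: oe].
by apply: eq_bigr => i _; rewrite ipC ip_combo_orthonormal// ltn_ord expr2.
Qed.

(** The residual of [f] after projection on the first [n] vectors has a nonnegative
    square norm, which is the difference of the two sides. *)
Lemma bessel (e : nat -> T -> R) f n : orthonormal e -> f \in Lfun mu 2%:E ->
  \sum_(k < n) ip f (e k) ^+ 2 <= ip f f.
Proof.
move=> oe lf; pose p := \sum_(k < n) ip f (e k) *: e k.
have le k : e k \in Lfun mu 2%:E by case: oe.
have lp : p \in Lfun mu 2%:E by apply: (Lfun2_combo n (fun k => ip f (e k))).
have pE : ip p f = \sum_(k < n) ip f (e k) ^+ 2.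
  by rewrite /p (@ip_suml n (fun k => ip f (e k)))//; apply: eq_bigr => i _;
    rewrite (ipC (e i)) expr2.
have := ip_ge0 (f + (-1) *: p).
have lZ : (-1) *: p \in Lfun mu 2%:E by exact: Lfun2Z.
rewrite ipDl ?Lfun2D// ipZl ?Lfun2D// !(ipC _ (f + _)) !ipDl// !ipZl//.
rewrite (ipC f p) pE /p (@pythagoras e (fun k => ip f (e k)))//; lra.
Qed.

End L2_inner_product.

(** * Completeness of L_2 *)

Lemma sum_expr_half_le (R : realType) n : \sum_(0 <= k < n) 2^-1 ^+ k <= 2 :> R.
Proof.
have := @geometric_le_lim R n 1 2^-1 ler01.
rewrite invr_gt0 ltr0n => /(_ isT); rewrite gtr0_norm ?invr_gt0//.
rewrite invf_lt1// ltr1n => /(_ isT).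
rewrite (_ : 1 / (1 - 2^-1) = 2 :> R); last by field.
by apply: le_trans; rewrite /series/=; apply: ler_sum => k _; rewrite mul1r.
Qed.

Lemma cvge0P (R : realType) (I : Type) (F : set_system I) (FF : Filter F)
    (f : I -> \bar R) : (forall i, (0 <= f i)%E) ->
  (f i @[i --> F] --> 0%E) <->
  (forall e, 0 < e -> \forall i \near F, (f i <= e%:E)%E).
Proof.
move=> f0; split.
  move=> /fine_cvgP[ffin /cvgrPdist_le f1] e e0.
  move: ffin (f1 _ e0); apply: filterS2 => i fi /=.
  by rewrite sub0r normrN ger0_norm ?fine_ge0// -lee_fin fineK.
move=> fe; apply/fine_cvgP; split.
  apply: filterS (fe 1 ltr01) => i fi1.
  by rewrite ge0_fin_numE// (le_lt_trans fi1)// ltry.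
apply/cvgrPdist_le => e e0; apply: filterS (fe e e0) => i /= fie.
rewrite sub0r normrN ger0_norm ?fine_ge0// -lee_fin fineK//.
by rewrite ge0_fin_numE// (le_lt_trans fie)// ltry.
Qed.

Section L2_complete.
Context d (T : measurableType d) (R : realType).
Variable mu : {measure set T -> \bar R}.
Implicit Types f g : T -> R.

Lemma L2norm_le f (e : R) : 0 <= e ->
  (L2norm mu f <= e%:E)%E = (\int[mu]_x (f x ^+ 2)%:E <= (e ^+ 2)%:E)%E.
Proof.
move=> e0; rewrite /L2norm unlock.
have -> : (\int[mu]_x (`|(EFin \o f) x| `^ 2) = \int[mu]_x (f x ^+ 2)%:E)%E.
  by apply: eq_integral => x _ /=; rewrite powR_mulrn// -normrX ger0_norm ?sqr_ge0.
have : (0 <= \int[mu]_x (f x ^+ 2)%:E)%E.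
  by apply: integral_ge0 => x _; rewrite lee_fin sqr_ge0.
case: (\int[mu]_x _)%E => [r| |//];
  last by rewrite poweRyr ?invr_eq0 ?pnatr_eq0// !leye_eq.
rewrite !lee_fin => r0; rewrite powR12_sqrt//.
by rewrite -{1}(ger0_norm e0) -sqrtr_sqr ler_sqrt// sqr_ge0.
Qed.

Lemma Lfun2_le f (e : R) : measurable_fun setT f -> (L2norm mu f <= e%:E)%E ->
  f \in Lfun mu 2%:E.
Proof.
by move=> mf fe; apply/andP; split; rewrite inE//= /finite_norm (le_lt_trans fe)// ltry.
Qed.

Lemma Lfun2_sqr f : measurable_fun setT f ->
  mu.-integrable setT (EFin \o (fun x => f x ^+ 2)) -> f \in Lfun mu 2%:E.
Proof.
move=> mf f2; have If := integrable_fin_num measurableT f2.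
have I0 : (0 <= \int[mu]_x (f x ^+ 2)%:E)%E.
  by apply: integral_ge0 => x _; rewrite lee_fin sqr_ge0.
pose e := Num.sqrt (fine (\int[mu]_x (f x ^+ 2)%:E)%E).
apply: (@Lfun2_le _ e) => //; rewrite L2norm_le ?sqrtr_ge0//.
by rewrite /e sqr_sqrtr ?fine_ge0// fineK.
Qed.

(** Norm bounds are lower semicontinuous for pointwise convergence. *)
Lemma L2norm_fatou (u : nat -> T -> R) f (e : R) (k : nat) :
  (forall n, measurable_fun setT (u n)) ->
  (forall x, u ^~ x @ \oo --> f x) -> 0 <= e ->
  (forall n, (k <= n)%N -> (L2norm mu (u n) <= e%:E)%E) ->
  (L2norm mu f <= e%:E)%E.
Proof.
move=> mu_ uf e0 ue; rewrite L2norm_le//.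
pose v (n : nat) : T -> \bar R := fun x => ((u (n + k)%N x) ^+ 2)%:E.
have mv n : measurable_fun setT (v n).
  by apply/measurable_EFinP; exact: measurable_funX.
have v0 n x : setT x -> (0 <= v n x)%E by rewrite lee_fin sqr_ge0.
have := fatou mu measurableT mv v0.
have -> : (\int[mu]_x limn_einf (v^~ x) = \int[mu]_x (f x ^+ 2)%:E)%E.
  apply: eq_integral => x _.
  suff /cvg_limn_einf_sup[-> _] : (v^~ x @ \oo --> (f x ^+ 2)%:E)%E by [].
  apply: cvg_EFin; first exact: nearW.
  have us : u (n + k)%N x @[n --> \oo] --> f x.
    by rewrite (cvg_shiftn k (u ^~ x)); exact: uf.
  exact: (cvgM us us).
move=> /le_trans; apply; rewrite limn_einf_lim; apply: lime_le.
  exact: is_cvg_einfs.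
apply: nearW => n; apply: (@le_trans _ _ (\int[mu]_x v n x)%E).
  by apply: ereal_inf_lbound; exists n => /=.
by rewrite -L2norm_le// ue// leq_addl.
Qed.

(** The series [\sum_k 2 ^ k * (v_(k+1) - v_k) ^ 2] has integral at most
    [\sum_k 2 ^ k * 4 ^ - k = 2], hence is finite almost everywhere. Where it is
    finite, [a <= 2 ^ - k + 2 ^ k * a ^ 2] for [a = |v_(k+1) - v_k|] makes the
    increments absolutely summable. *)
Lemma ae_cvg_fast_cauchy (v : nat -> T -> R) :
  (forall k, measurable_fun setT (v k)) ->
  (forall k, (L2norm mu (v k.+1 - v k)%R <= (2^-1 ^+ k)%:E)%E) ->
  exists2 A, measurable A & mu (~` A) = 0 /\
    forall x, A x -> cvgn (v ^~ x).
Proof.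
move=> mv vk.
pose g (k : nat) : T -> R := fun x => v k.+1 x - v k x.
have mg k : measurable_fun setT (g k) by exact: measurable_funB.
pose h (k : nat) : T -> \bar R := fun x => (2 ^+ k * g k x ^+ 2)%:E.
have mh k : measurable_fun setT (h k).
  by apply/measurable_EFinP; apply: measurable_funM => //; exact: measurable_funX.
have h0 k x : (0 <= h k x)%E by rewrite lee_fin mulr_ge0 ?sqr_ge0 ?exprn_ge0.
pose H : T -> \bar R := fun x => (\sum_(k <oo) h k x)%E.
have mH : measurable_fun setT H.
  apply: (@emeasurable_fun_cvg _ _ _ _ (fun n x => \sum_(0 <= k < n) h k x)%E).
    by move=> n; exact: emeasurable_sum.
  by move=> x _; apply: is_cvg_nneseries.
have H0 x : (0 <= H x)%E by apply: nneseries_ge0 => n _ _; exact: h0.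
have intH : (\int[mu]_x H x <= 2%:E)%E.
  rewrite integral_nneseries//; apply: lime_le.
    by apply: is_cvg_nneseries => n _ _; exact: integral_ge0.
  apply: nearW => n.
  apply: (@le_trans _ _ (\sum_(0 <= k < n) (2^-1 ^+ k)%:E)%E).
    apply: lee_sum => k _; rewrite /h.
    under eq_integral do rewrite EFinM.
    rewrite ge0_integralZl//; last 2 first.
    - by apply/measurable_EFinP; exact: measurable_funX.
    - by move=> x _; rewrite lee_fin sqr_ge0.
    have := vk k; rewrite L2norm_le ?exprn_ge0 ?invr_ge0// => le1.
    apply: (@le_trans _ _ ((2 ^+ k)%:E * ((2^-1 ^+ k) ^+ 2)%:E)%E).
      by apply: lee_wpmul2l => //; rewrite lee_fin exprn_ge0.
    by rewrite -EFinM lee_fin expr2 mulrA -exprMn divff// expr1n mul1r.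
  rewrite sumEFin lee_fin.
  exact: sum_expr_half_le.
have intH' : mu.-integrable setT H.
  apply/integrableP; split=> //; under eq_integral do rewrite gee0_abs//.
  by rewrite (le_lt_trans intH)// ltry.
exists [set x | (H x < +oo)%E].
  by rewrite -(setTI [set x | _]); exact: emeasurable_fun_infty_o.
split.
  have [N [mN N0 sN]] := integrable_ae measurableT intH'.
  apply/eqP; rewrite eq_le measure_ge0 andbT -N0; apply: le_measure => //.
  - rewrite inE; apply: measurableC; rewrite -(setTI [set x | _]).
    exact: emeasurable_fun_infty_o.
  - by rewrite inE.
  - by move=> x /= Hx; apply: sN => /= /(_ I); rewrite ge0_fin_numE.
move=> x /= Hx.
have Hfin : H x \is a fin_num by rewrite ge0_fin_numE.
have bnd n : \sum_(0 <= k < n) 2 ^+ k * g k x ^+ 2 <= fine (H x).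
  rewrite -lee_fin fineK// -sumEFin; apply: nneseries_lim_ge => k _ _.
  exact: h0.
have /normed_cvg : cvgn [normed series (telescope (v ^~ x))].
  apply: nondecreasing_is_cvgn.
    by apply: nondecreasing_series => n _ _ /=; exact: normr_ge0.
  exists (2 + fine (H x)) => _ [n _ <-]; rewrite /series/=.
  apply: (@le_trans _ _ (\sum_(0 <= k < n) (2^-1 ^+ k + 2 ^+ k * g k x ^+ 2))).
    apply: ler_sum => k _; rewrite /telescope -/(g k x).
    set p := 2 ^+ k : R; have p0 : 0 < p by rewrite exprn_gt0.
    rewrite exprVn -/p -(real_normK (num_real (g k x))); set a := `|g k x|.
    rewrite -(ler_pM2l p0) mulrDr divff ?gt_eqF//.
    have := sqr_ge0 (p * a - 1); have : 0 <= p * a by rewrite mulr_ge0 ?normr_ge0// ltW.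
    nra.
  rewrite big_split/= lerD//.
  exact: sum_expr_half_le.
rewrite telescopeK => cv.
rewrite (_ : v ^~ x = [sequence v n x - v 0%N x]_n + cst (v 0%N x)).
  exact: (is_cvgD cv (is_cvg_cst _)).
by apply/funext => n; rewrite fctE /= subrK.
Qed.

(** Riesz-Fischer. A fast subsequence converges almost everywhere, and Fatou's lemma
    turns the Cauchy estimates between its members into estimates for the limit. *)
Lemma L2_complete (u : nat -> T -> R) :
  (forall n, u n \in Lfun mu 2%:E) ->
  (forall e, 0 < e -> exists N, forall m n, (N <= m)%N -> (N <= n)%N ->
     (L2norm mu (u m - u n)%R <= e%:E)%E) ->
  exists f, L2_cvg mu u f.
Proof.
move=> lu cu.
have mu_ n : measurable_fun setT (u n) by exact: Lfun_measurable (lu n).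
have /choice[N NP] (k : nat) : exists N, forall m n, (N <= m)%N -> (N <= n)%N ->
    (L2norm mu (u m - u n)%R <= (2^-1 ^+ k)%:E)%E.
  by apply: cu; rewrite exprn_gt0// invr_gt0.
(* The maximum makes [p k] lie beyond all of [N 0, ..., N k]. *)
pose p k := (\max_(j < k.+1) N j)%N.
have Np j k : (j <= k)%N -> (N j <= p k)%N.
  move=> jk; pose j' := Ordinal (jk : (j < k.+1)%N).
  exact: (leq_bigmax (F := fun i : 'I_k.+1 => N i) j').
have [A mA [A0 Acvg]] : exists2 A, measurable A & mu (~` A) = 0 /\
    forall x, A x -> cvgn (fun k => u (p k) x).
  apply: (@ae_cvg_fast_cauchy (fun k => u (p k))) => // k.
  by apply: NP; apply: Np.
(* Cutting off on the null set [~` A] turns almost sure convergence into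
   convergence everywhere, hence gives a measurable limit. *)
pose w (k : nat) : T -> R := fun x => \1_A x * u (p k) x.
have mw k : measurable_fun setT (w k) by apply: measurable_funM.
pose f : T -> R := fun x => limn (w ^~ x).
have wf x : w ^~ x @ \oo --> f x.
  apply/cvg_ex; rewrite /w /indic; have [/set_mem Ax|nAx] := boolP (x \in A).
    have /cvg_ex[l ul] := Acvg _ Ax; exists (1 * l); apply: cvgM => //; exact: cvg_cst.
  exists 0; under eq_fun do rewrite mul0r; exact: cvg_cst.
have mf : measurable_fun setT f.
  by apply: (@measurable_fun_cvg _ _ _ _ w) => // x _; exact: wf.
have ufle k m : (N k <= m)%N -> (L2norm mu (u m - f)%R <= (2^-1 ^+ k)%:E)%E.
  move=> km; apply: (@L2norm_fatou (fun n => u m - w n) _ _ k).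
  - by move=> n; exact: measurable_funB.
  - by move=> x; apply: cvgB; [exact: cvg_cst|exact: wf].
  - by rewrite exprn_ge0// invr_ge0.
  move=> n kn; rewrite L2norm_le ?exprn_ge0 ?invr_ge0//.
  have := NP k m (p n) km (Np _ _ kn); rewrite L2norm_le ?exprn_ge0 ?invr_ge0//.
  apply: le_trans; rewrite le_eqVlt; apply/orP; left; apply/eqP.
  apply: ge0_ae_eq_integral => //.
  - by apply/measurable_EFinP; apply: measurable_funX; exact: measurable_funB.
  - by apply/measurable_EFinP; apply: measurable_funX; exact: measurable_funB.
  - by move=> x _; rewrite lee_fin sqr_ge0.
  - by move=> x _; rewrite lee_fin sqr_ge0.
  exists (~` A); split => //; first exact: measurableC.
  move=> x /= + Ax; apply => _; rewrite /w.
  by rewrite !fctE /= indicE mem_set// mul1r.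
have lf : f \in Lfun mu 2%:E.
  rewrite (_ : f = u (N 0%N) - (u (N 0%N) - f)); last by rewrite opprB addrC subrK.
  apply: Lfun2B => //; apply: (@Lfun2_le _ (2^-1 ^+ 0)); last exact: ufle.
  exact: measurable_funB.
exists f; split => //.
apply/cvge0P => [n|e e0]; first exact: Lnorm_ge0.
have [k ke] : exists k, 2^-1 ^+ k <= e.
  have /cvgrPdist_le/(_ _ e0)[k _ kP] : (2^-1 ^+ k : R) @[k --> \oo] --> 0.
    by apply: cvg_expr; rewrite gtr0_norm ?invr_gt0// invf_lt1// ltr1n.
  exists k; have := kP k (leqnn k).
  by rewrite /= sub0r normrN ger0_norm// exprn_ge0// invr_ge0.
exists (N k) => // n /= Nn; rewrite (le_trans (ufle _ _ Nn))// lee_fin.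
Qed.

End L2_complete.

(** * Orthonormal series and isometries *)

Section L2_series.
Context d (T : measurableType d) (R : realType).
Variable mu : {measure set T -> \bar R}.
Implicit Types (f g : T -> R) (e : nat -> T -> R) (b c : nat -> R).

Lemma L2normD f g : f \in Lfun mu 2%:E -> g \in Lfun mu 2%:E ->
  (L2norm mu (f + g)%R <= L2norm mu f + L2norm mu g)%E.
Proof.
by move=> lf lg; apply: eminkowski;
  [exact: Lfun_measurable lf|exact: Lfun_measurable lg|exact: lee1n].
Qed.

Lemma L2normZ a f : f \in Lfun mu 2%:E ->
  L2norm mu (a *: f) = (`|a|%:E * L2norm mu f)%E.
Proof.
move=> lf; have lZ := Lfun2Z a lf.
rewrite !L2norm_ip// ipZl// ipC ipZl// mulrA -expr2 sqrtrM ?sqr_ge0//.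
by rewrite sqrtr_sqr EFinM.
Qed.

Lemma L2norm_ae_eq f g : measurable_fun setT f -> measurable_fun setT g ->
  {ae mu, forall x, f x = g x} -> L2norm mu f = L2norm mu g.
Proof.
move=> mf mg fg; rewrite /L2norm unlock; congr (_ `^ _)%E.
have mp (h : T -> R) : measurable_fun setT h ->
  measurable_fun setT (fun x => (`|(EFin \o h) x| `^ 2)%E).
  move=> mh; apply: (@measurableT_comp _ _ _ _ _ _ (fun x : \bar R => x `^ 2)%E).
    exact: measurable_poweR.
  by apply: measurableT_comp => //; exact/measurable_EFinP.
apply: ge0_ae_eq_integral => //; [exact: mp|exact: mp|..].
- by move=> x _; exact: poweR_ge0.
- by move=> x _; exact: poweR_ge0.
- by apply: filterS fg => x /= -> _.
Qed.

Lemma partial_sumE (u : nat -> T -> R) n : partial_sum u n = \sum_(k < n) u k.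
Proof. by apply/funext => x; rewrite /partial_sum fct_sumE. Qed.

Lemma partial_sum_combo b e n :
  partial_sum (fun k x => b k * e k x) n = \sum_(k < n) b k *: e k.
Proof. exact: partial_sumE. Qed.

Lemma L2norm_combo_le e b n (C : R) : orthonormal mu e -> 0 <= C ->
  \sum_(k < n) b k ^+ 2 <= C ^+ 2 ->
  (L2norm mu (\sum_(k < n) b k *: e k)%R <= C%:E)%E.
Proof.
move=> oe C0 bC; rewrite L2norm_ip; last by apply: Lfun2_combo; case: oe.
by rewrite pythagoras// lee_fin -[leRHS](ger0_norm C0) -sqrtr_sqr ler_wsqrtr.
Qed.

(** The partial sums of [\sum_k b_k ^ 2] form a Cauchy sequence and, by Pythagoras,
    their differences are the squared distances between those of the series. *)
Lemma orthonormal_series_cvg e b (C : R) : orthonormal mu e ->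
  (forall n, \sum_(k < n) b k ^+ 2 <= C) ->
  exists f, L2_cvg mu (partial_sum (fun k x => b k * e k x)) f.
Proof.
move=> oe bC; have le k : e k \in Lfun mu 2%:E by case: oe.
apply: L2_complete => [n|eps eps0].
  by rewrite partial_sum_combo; exact: Lfun2_combo.
pose s n := \sum_(0 <= k < n) b k ^+ 2.
have cs : cvgn s.
  apply: nondecreasing_is_cvgn.
    by apply: nondecreasing_series => n _ _; exact: sqr_ge0.
  by exists C => _ [n _ <-]; rewrite /s big_mkord.
have /cvg_ex[l /cvgrPdist_le sl] := cs.
have e2 : 0 < eps ^+ 2 / 2 by rewrite divr_gt0// exprn_gt0.
have [N _ NP] := sl _ e2; exists N.
have tail m n : (N <= n)%N -> (n <= m)%N ->
    (L2norm mu (partial_sum (fun k x => b k * e k x) m -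
       partial_sum (fun k x => b k * e k x) n)%R <= eps%:E)%E.
  move=> Nn nm; rewrite !partial_sum_combo.
  pose c k := if (n <= k)%N then b k else 0.
  have -> : \sum_(k < m) b k *: e k - \sum_(k < n) b k *: e k = \sum_(k < m) c k *: e k.
    apply/eqP; rewrite subr_eq; apply/eqP.
    rewrite (big_ord_widen m (fun k => b k *: e k) nm).
    rewrite [X in _ = _ + X]big_mkcond -big_split/=.
    apply: eq_bigr => k _; rewrite /c; case: ltnP => _; first by rewrite scale0r add0r.
    by rewrite addr0.
  apply: L2norm_combo_le => //; first exact: ltW.
  have -> : \sum_(k < m) c k ^+ 2 = s m - s n.
    apply/eqP; rewrite eq_sym subr_eq /s !big_mkord; apply/eqP.
    rewrite (big_ord_widen m (fun k => b k ^+ 2) nm) [X in _ = _ + X]big_mkcond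
      -big_split/=.
    apply: eq_bigr => k _; rewrite /c; case: ltnP => _; last by rewrite addr0.
    by rewrite expr0n add0r.
  have := NP m (leq_trans Nn nm); have := NP n Nn.
  by rewrite /= !ler_norml => /andP[? ?] /andP[? ?]; lra.
move=> m n Nm Nn; have [nm|/ltnW mn] := leqP n m; first exact: tail.
rewrite -opprB -scaleN1r L2normZ; last first.
  by apply: Lfun2B; rewrite partial_sum_combo; exact: Lfun2_combo.
by rewrite normrN1 mul1e; exact: tail.
Qed.

Lemma L2_sumP (u : nat -> T -> R) f : L2_cvg mu (partial_sum u) f ->
  L2_cvg mu (partial_sum u) (L2_sum mu u).
Proof.
move=> uf; rewrite /L2_sum; case: xgetP => [g _ //|].
by move=> /(_ f) /(_ uf).
Qed.

Lemma L2_cvg_linear (u v : nat -> T -> R) f g (a : R) :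
  L2_cvg mu u f -> L2_cvg mu v g ->
  L2_cvg mu (fun n => a *: u n + v n) (a *: f + g).
Proof.
move=> [lu lf uf] [lv lg vg]; split => [n||].
- by apply: Lfun2D => //; exact: Lfun2Z.
- by apply: Lfun2D => //; exact: Lfun2Z.
have luf n : u n - f \in Lfun mu 2%:E by exact: Lfun2B.
have lvg n : v n - g \in Lfun mu 2%:E by exact: Lfun2B.
apply: (@squeeze_cvge _ _ _ _ (fun=> 0%E) _
  (fun n => `|a|%:E * L2norm mu (u n - f)%R + L2norm mu (v n - g)%R)%E).
- apply: nearW => n; rewrite Lnorm_ge0 -L2normZ//=.
  have -> : (a *: u n + v n \- (a *: f + g))%R = a *: (u n - f) + (v n - g).
    by rewrite -[LHS]/(a *: u n + v n - (a *: f + g)) scalerBr opprD addrACA.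
  by apply: L2normD => //; exact: Lfun2Z.
- exact: cvg_cst.
- rewrite -[X in _ --> X](adde0 0%E); apply: cvgeD => //.
  by rewrite -(mule0 `|a|%:E); apply: cvgeZl.
Qed.

Lemma L2_cvg_norm_le (u : nat -> T -> R) f (C : R) : L2_cvg mu u f ->
  (forall n, (L2norm mu (u n) <= C%:E)%E) -> (L2norm mu f <= C%:E)%E.
Proof.
move=> [lu lf uf] uC; apply/lee_addgt0Pr => eps eps0.
have [n _ /(_ n (leqnn n))/= un] := (@cvge0P _ _ \oo _ _
  (fun n => Lnorm_ge0 mu 2%:E (EFin \o (u n \- f)))).1 uf _ eps0.
have -> : f = u n + (-1) *: (u n - f) by rewrite scaleN1r opprB addrC subrK.
have luf : u n - f \in Lfun mu 2%:E by exact: Lfun2B.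
apply: (le_trans (L2normD (lu n) (Lfun2Z (-1) luf))).
by rewrite leeD// L2normZ// normrN1 mul1e.
Qed.

Lemma L2_cvg_unique (u : nat -> T -> R) f g : L2_cvg mu u f -> L2_cvg mu u g ->
  L2norm mu (f - g) = 0%E.
Proof.
move=> uf ug; have := L2_cvg_linear (-1) ug uf => ufg.
apply/eqP; rewrite eq_le Lnorm_ge0 andbT.
rewrite [X in L2norm _ X](_ : _ = (-1) *: g + f); last by rewrite scaleN1r addrC.
apply: (L2_cvg_norm_le ufg) => n.
rewrite scaleN1r addNr L2norm_le//; under eq_integral do rewrite expr0n.
by rewrite integral0 expr0n.
Qed.

End L2_series.

Section L2_isometry.
Context d (T : measurableType d) d' (T' : measurableType d') (R : realType).
Variables (mu : {measure set T -> \bar R}) (P : {measure set T' -> \bar R}).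
Variable iso : (T -> R) -> (T' -> R).
Hypothesis iso_Lfun : forall f, f \in Lfun mu 2%:E -> iso f \in Lfun P 2%:E.
Hypothesis iso_linear : forall (a : R) f g,
  f \in Lfun mu 2%:E -> g \in Lfun mu 2%:E ->
  {ae P, forall w, iso (a *: f + g) w = a * iso f w + iso g w}.
Hypothesis iso_norm : forall f, f \in Lfun mu 2%:E ->
  L2norm P (iso f) = L2norm mu f.

Let combo (s : seq (R * (T -> R))) : T -> R := \sum_(p <- s) p.1 *: p.2.
Let icombo (s : seq (R * (T -> R))) : T' -> R := \sum_(p <- s) p.1 *: iso p.2.

(** Linearity of [iso] only holds almost everywhere, for two terms at a time; the
    null sets of finitely many steps are collected here once and for all. The list
    form covers differences, difference quotients and remainders of series. *)
Lemma L2norm_iso_combo (s : seq (R * (T -> R))) :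
  (forall p, List.In p s -> p.2 \in Lfun mu 2%:E) ->
  L2norm P (icombo s) = L2norm mu (combo s).
Proof.
move=> ls.
suff [lc [lic isoE]] : combo s \in Lfun mu 2%:E /\ icombo s \in Lfun P 2%:E /\
    {ae P, forall w, iso (combo s) w = icombo s w}.
  rewrite -iso_norm//; apply: L2norm_ae_eq.
  - exact: Lfun_measurable lic.
  - by apply: Lfun_measurable; exact: iso_Lfun.
  - by apply: filterS isoE => w ->.
rewrite /combo /icombo; elim: s ls => [|[a f] s IH] ls.
  rewrite !big_nil.
  have l0 : (0 : T -> R) \in Lfun mu 2%:E by have [] := Lfun_submod_closed mu (lee1n 2).
  have l0' : (0 : T' -> R) \in Lfun P 2%:E by have [] := Lfun_submod_closed P (lee1n 2).
  do 2 split=> //; have := iso_linear 1 l0 l0; apply: filterS => w.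
  rewrite scaler0 addr0 mul1r => /eqP; rewrite -subr_eq0 opprD addNKr oppr_eq0 => /eqP.
  by [].
rewrite !big_cons/=.
have lf : f \in Lfun mu 2%:E by apply: (ls (a, f)); left.
have [p ps|lc [lic isoE]] := IH; first by apply: ls; right.
split; first by apply: Lfun2D => //; exact: Lfun2Z.
split; first by apply: Lfun2D => //; apply: Lfun2Z; exact: iso_Lfun.
by apply: filterS2 (iso_linear a lf lc) isoE => w -> ->.
Qed.

Lemma L2norm_isoB f g : f \in Lfun mu 2%:E -> g \in Lfun mu 2%:E ->
  L2norm P (iso f - iso g) = L2norm mu (f - g).
Proof.
move=> lf lg; have := @L2norm_iso_combo [:: (1, f); (-1, g)].
rewrite /icombo /combo !big_cons !big_nil/= !addr0 !scale1r !scaleN1r; apply.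
by move=> p [<-|[<-|//]].
Qed.

Lemma L2norm_iso_diff_quotient (c : R) f g k : f \in Lfun mu 2%:E ->
  g \in Lfun mu 2%:E -> k \in Lfun mu 2%:E ->
  L2norm P (c *: (iso f - iso g) - iso k) = L2norm mu (c *: (f - g) - k).
Proof.
move=> lf lg lk; have := @L2norm_iso_combo [:: (c, f); (- c, g); (-1, k)].
rewrite /icombo /combo !big_cons !big_nil/= !addr0 !scaleN1r !scalerBr !scaleNr
  !addrA; apply.
by move=> p [<-|[<-|[<-|//]]].
Qed.

Lemma L2_cvg_iso (e : nat -> T -> R) (b : nat -> R) f :
  (forall k, e k \in Lfun mu 2%:E) ->
  L2_cvg mu (partial_sum (fun k x => b k * e k x)) f ->
  L2_cvg P (partial_sum (fun k w => b k * iso (e k) w)) (iso f).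
Proof.
move=> le [_ lf ef]; split; [|exact: iso_Lfun|].
  move=> n; rewrite (partial_sum_combo b (fun k => iso (e k))).
  by apply: (@Lfun2_combo _ _ _ _ n b (fun k => iso (e k))) => k; exact: iso_Lfun.
apply: cvg_trans ef; apply: near_eq_cvg; apply: nearW => n.
rewrite (partial_sum_combo b (fun k => iso (e k))) partial_sum_combo.
have := @L2norm_iso_combo (rcons [seq (b k, e k) | k <- index_iota 0 n] (-1, f)).
rewrite /icombo /combo -cats1 !big_cat/= !big_seq1 !big_map !big_mkord/= !scaleN1r
  => -> //.
move=> p ps; have [pb|[<-//|//]] := List.in_app_or _ _ _ ps.
have [k [<- _]] := (List.in_map_iff _ _ _).1 pb; exact: le.
Qed.

End L2_isometry.

(** * Orthonormality of the Hermite functions *)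

Section gaussian_weight.
Context (R : realType).
Implicit Types (p q : {poly R}) (x : R).
Let mu := @lebesgue_measure R.

Definition poly_gauss p : R -> R := fun x => p.[x] * gauss_fun x.

(** The polynomial [q] with [poly_gauss q] the derivative of [poly_gauss p]. *)
Definition deriv_gauss p : {poly R} := p^`() - (2 *: 'X) * p.

Lemma is_derive_poly_gauss p x :
  is_derive x 1 (poly_gauss p) (poly_gauss (deriv_gauss p) x).
Proof.
have dp := is_derive_poly p x.
have dg : is_derive x 1 (@gauss_fun R) (expR (- x ^+ 2) * - (2 * x)).
  have d2 : is_derive x 1 (fun y : R => - y ^+ 2) (- (2 * x)).
    have := is_deriveN (is_deriveX 2 (is_derive_id x (1 : R))).
    by rewrite /= expr1 scaler1.
  exact: (is_derive1_comp (is_derive_expR _) d2).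
have /is_derive_eq := is_deriveM dp dg; apply.
rewrite /poly_gauss /deriv_gauss !hornerE /gauss_fun /GRing.scale /=; ring.
Qed.

Lemma continuous_poly_gauss p : continuous (poly_gauss p).
Proof.
move=> x; apply/differentiable_continuous/derivable1_diffP.
by have [] := is_derive_poly_gauss p x.
Qed.

(** Each monomial is controlled by one term of the exponential series of
    [x ^ 2 / 2], after bounding [|x ^ k|] by [1 + (x ^ 2) ^ k]. *)
Lemma poly_le_expR p : exists2 C, 0 <= C & forall x, `|p.[x]| <= C * expR (x ^+ 2 / 2).
Proof.
have mono k x : `|x ^+ k| <= (1 + 2 ^+ k * k`!%:R) * expR (x ^+ 2 / 2).
  have y0 : 0 <= x ^+ 2 / 2 by rewrite divr_ge0// sqr_ge0.
  have e1 : 1 <= expR (x ^+ 2 / 2) by have := expR_ge1Dx (x ^+ 2 / 2); lra.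
  have xk : `|x ^+ k| <= 1 + (x ^+ 2) ^+ k.
    rewrite exprAC -(real_normK (num_real (x ^+ k))).
    by have := sqr_ge0 (`|x ^+ k| - 1); have := normr_ge0 (x ^+ k); nra.
  have yk : (x ^+ 2) ^+ k <= 2 ^+ k * k`!%:R * expR (x ^+ 2 / 2).
    have -> : (x ^+ 2) ^+ k = 2 ^+ k * (x ^+ 2 / 2) ^+ k by rewrite -exprMn mulrC divfK.
    rewrite -mulrA ler_wpM2l ?exprn_ge0//.
    case: k {xk} => [|k]; first by rewrite expr0 fact0 mul1r.
    have f0 : (0 : R) < k.+1`!%:R by rewrite ltr0n fact_gt0.
    rewrite -ler_pdivrMl// mulrC.
    by have := expR_ge1Dxn k y0; lra.
  by rewrite mulrDl mul1r (le_trans xk)// lerD.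
exists (\sum_(i < size p) `|p`_i| * (1 + 2 ^+ i * i`!%:R)).
  by apply: sumr_ge0 => i _; rewrite mulr_ge0// addr_ge0// mulr_ge0// exprn_ge0.
move=> x; rewrite horner_coef (le_trans (ler_norm_sum _ _ _))// mulr_suml.
by apply: ler_sum => i _; rewrite normrM -mulrA ler_wpM2l.
Qed.

Lemma gauss_fun_half x : gauss_fun x = expR (- (x ^+ 2 / 2)) * expR (- (x ^+ 2 / 2)).
Proof. by rewrite -expRD /gauss_fun; congr expR; field. Qed.

Lemma integrable_expR_half :
  mu.-integrable setT (EFin \o (fun x => expR (- (x ^+ 2 / 2)))).
Proof.
have := integrableZl measurableT (normal_peak (1 : R))^-1
  (integrable_normal_pdf (0 : R) 1).
apply: eq_integrable => // x _;
  rewrite /= normal_pdfE ?oner_eq0// -EFinM mulrA mulVf ?mul1r.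
  by rewrite /normal_fun subr0 expr1n mulNr.
by rewrite gt_eqF// normal_peak_gt0// oner_eq0.
Qed.

Lemma integrable_poly_gauss p : mu.-integrable setT (EFin \o poly_gauss p).
Proof.
have [C C0 pC] := poly_le_expR p.
apply: le_integrable (integrableZl measurableT C integrable_expR_half) => //.
  apply/measurable_EFinP; apply: continuous_measurable_fun;
    exact: continuous_poly_gauss.
move=> x _; rewrite /= lee_fin /poly_gauss gauss_fun_half.
have := pC x; rewrite -ler_pdivrMr ?expR_gt0// -expRN.
set e := expR _ => pe; have e0 : 0 <= e by exact: expR_ge0.
by rewrite mulrA normrM [leRHS]normrM ler_wpM2r// normrM (ger0_norm e0) (ger0_norm C0).
Qed.

(** The factor [|x|] makes [poly_gauss p] vanish at infinity. *)
Lemma poly_gauss_bound p : exists C, forall x, `|x| * `|poly_gauss p x| <= C.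
Proof.
have [C C0 pC] := poly_le_expR ('X * p).
exists C => x; have := pC x;
  rewrite /poly_gauss gauss_fun_half -ler_pdivrMr ?expR_gt0//.
rewrite -expRN hornerM hornerX normrM.
have : expR (- (x ^+ 2 / 2)) <= 1.
  by rewrite -[leRHS]expR0 ler_expR oppr_le0 divr_ge0// sqr_ge0.
set e := expR _ => e1 pe; have e0 : 0 <= e by exact: expR_ge0.
by rewrite !normrM (ger0_norm e0) !mulrA (le_trans (ler_piMr _ e1))// !mulr_ge0.
Qed.

Definition gauss_int p : R := \int[mu]_x poly_gauss p x.

Lemma gauss_intD p q : gauss_int (p + q) = gauss_int p + gauss_int q.
Proof.
rewrite /gauss_int -RintegralD//; [|exact: integrable_poly_gauss..].
by apply: eq_Rintegral => x _; rewrite /poly_gauss hornerD mulrDl.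
Qed.

Lemma gauss_intZ a p : gauss_int (a *: p) = a * gauss_int p.
Proof.
rewrite /gauss_int -RintegralZl//; last exact: integrable_poly_gauss.
by apply: eq_Rintegral => x _; rewrite /poly_gauss hornerZ mulrA.
Qed.

Lemma gauss_int1 : gauss_int 1 = Num.sqrt pi.
Proof.
rewrite /gauss_int /Rintegral; under eq_integral do rewrite /poly_gauss hornerC mul1r.
by rewrite integralT_gauss.
Qed.

(** The integral over [[-n - 1, n + 1]] is a difference of boundary values of
    [poly_gauss p], which vanish in the limit. *)
Lemma gauss_int_deriv_gauss p : gauss_int (deriv_gauss p) = 0.
Proof.
pose q := deriv_gauss p.
have iq := integrable_poly_gauss q.
have mq : measurable_fun setT (poly_gauss q).
  by apply: continuous_measurable_fun; exact: continuous_poly_gauss.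
pose D n : set R := `[- n.+1%:R, n.+1%:R]%classic.
pose f_ n : R -> \bar R := (EFin \o poly_gauss q) \_ (D n).
have mD n : measurable (D n) by exact: measurable_itv.
have mf n : measurable_fun setT (f_ n).
  by apply/(measurable_restrictT _ _).1 => //; apply/measurable_EFinP/measurable_funTS.
have cf x : f_ ^~ x @ \oo --> (poly_gauss q x)%:E.
  apply: cvg_near_cst; near=> n.
  rewrite /f_ patchE mem_set// /D /= in_itv/= -ler_norml.
  rewrite (@le_trans _ _ n%:R) ?ler_nat//.
  by near: n; exact: nbhs_infty_ger.
have absf n x : (`|f_ n x| <= (abse \o (EFin \o poly_gauss q)) x)%E.
  by rewrite /f_ patchE; case: ifP => // _; rewrite abse0 abse_ge0.
have fcvg : {ae mu, forall x, setT x -> f_ ^~ x @ \oo --> (EFin \o poly_gauss q) x}.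
  by apply: nearW => x _; exact: cf.
have fdom : {ae mu, forall x n, setT x ->
  (`|f_ n x| <= (abse \o (EFin \o poly_gauss q)) x)%E}.
  by apply: nearW => x n _; exact: absf.
have [_ _] := @dominated_convergence _ (measurableTypeR R) R mu setT measurableT f_
  (EFin \o poly_gauss q)
  _ mf (measurable_int mu iq) fcvg (integrable_abse iq) fdom.
have intf n : (\int[mu]_x f_ n x =
    (poly_gauss p n.+1%:R)%:E - (poly_gauss p (- n.+1%:R))%:E)%E.
  rewrite -integral_mkcond; apply: continuous_FTC2.
  - by rewrite -subr_gt0 opprK addr_gt0.
  - by apply: continuous_subspaceT; exact: continuous_poly_gauss.
  - split.
    + by move=> x _; have [] := is_derive_poly_gauss p x.
    + by apply: cvg_at_right_filter; exact: continuous_poly_gauss.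
    + by apply: cvg_at_left_filter; exact: continuous_poly_gauss.
  - by move=> x _; rewrite derive1E; have [_ ->] := is_derive_poly_gauss p x.
under eq_fun do rewrite /= intf -EFinB.
move=> lim1.
suff lim0 : (poly_gauss p n.+1%:R - poly_gauss p (- n.+1%:R))%:E @[n --> \oo] --> 0%E.
  by rewrite /gauss_int /Rintegral (cvg_unique _ lim1 lim0).
have [C Cp] := poly_gauss_bound p.
have C0 : 0 <= C by apply: le_trans (Cp 0); rewrite normr0 mul0r.
have limC : 2 * C * n.+1%:R^-1 @[n --> \oo] --> 0.
  rewrite -(mulr0 (2 * C)); apply: cvgMl_tmp; exact: cvg_harmonic.
apply: cvg_EFin; first exact: nearW.
apply: (squeeze_cvgr _ _ limC); last first.
  rewrite -oppr0; exact: (cvgN limC).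
apply: nearW => n /=; rewrite -ler_norml.
rewrite (le_trans (ler_normB _ _))// mulrAC -mulrA mulr2n mulrDl mul1r.
have nx (x : R) : `|x| = n.+1%:R -> `|poly_gauss p x| <= C * n.+1%:R^-1.
  by move=> xn; rewrite ler_pdivlMr// mulrC -xn.
by rewrite lerD// mulrC nx// ?normrN normr_nat.
Unshelve. all: by end_near. Qed.

(** The Hermite polynomials up to sign: [poly_gauss (hpoly n)] is the [n]-th derivative
    of the Gaussian, so that integration by parts needs no bookkeeping. *)
Fixpoint hpoly n : {poly R} := if n is m.+1 then deriv_gauss (hpoly m) else 1.

Lemma derive1n_gauss n :
  derive1n n (fun y : R => expR (- y ^+ 2)) = poly_gauss (hpoly n).
Proof.
elim: n => [|n IH].
  by apply/funext => x; rewrite derive1n0 /poly_gauss hornerC mul1r.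
rewrite derive1nS IH; apply/funext => x.
by rewrite derive1E; have [_ ->] := is_derive_poly_gauss (hpoly n) x.
Qed.

(** [n] integrations by parts. *)
Lemma gauss_int_hpolyM n q : gauss_int (hpoly n * q) = (-1) ^+ n * gauss_int q^`(n).
Proof.
elim: n q => [|n IH] q; first by rewrite mul1r expr0 mul1r.
have -> : hpoly n.+1 * q = deriv_gauss (hpoly n * q) + (-1) *: (hpoly n * q^`()).
  rewrite /= /deriv_gauss derivM scaleN1r; ring.
by rewrite gauss_intD gauss_int_deriv_gauss add0r gauss_intZ IH derivSn exprS mulrA.
Qed.

Lemma size_hpoly n : (size (hpoly n) <= n.+1)%N /\ (hpoly n)`_n = (-2) ^+ n.
Proof.
elim: n => [|n [sn cn]]; first by rewrite /= size_poly1 coef1 expr0.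
split=> /=.
  rewrite /deriv_gauss (leq_trans (size_polyD _ _))// geq_max size_polyN.
  rewrite (leq_trans (size_poly _ _))/=; last first.
    by rewrite (leq_trans (leq_pred _))// ltnW.
  rewrite -scalerAl (leq_trans (size_scale_leq _ _))//.
  by rewrite (leq_trans (size_polyMleq _ _))// size_polyX.
rewrite /deriv_gauss coefB coef_deriv nth_default ?mul0rn ?sub0r; last first.
  by rewrite (leq_trans sn).
by rewrite -scalerAl coefZ coefXM/= cn exprS mulNr.
Qed.

(** Differentiating the polynomial [hpoly m], of degree [m], [n] times leaves
    nothing when [m < n], and [m!] times its leading coefficient when [m = n]. *)
Lemma gauss_int_hpoly m n : (m <= n)%N ->
  gauss_int (hpoly n * hpoly m) = 2 ^+ n * n`!%:R * Num.sqrt pi *+ (m == n).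
Proof.
move=> mn; rewrite gauss_int_hpolyM; have [sm cm] := size_hpoly m.
move: mn; rewrite leq_eqVlt => /predU1P[<-|mn]; last first.
  rewrite derivn_poly0 ?(leq_trans sm)// ltn_eqF//.
  by rewrite -(scale0r 1) gauss_intZ mul0r mulr0.
rewrite eqxx mulr1n.
have -> : (hpoly m)^`(m) = ((-2) ^+ m * m`!%:R) *: 1.
  apply/polyP => i; rewrite coef_derivn coefZ coef1.
  case: i => [|i]; first by rewrite addn0 ffactnn cm mulr1 mulr_natr.
  by rewrite nth_default ?mul0rn ?mulr0// (leq_trans sm)// addnS ltnS leq_addr.
by rewrite gauss_intZ gauss_int1 !mulrA -exprMn mulrNN mul1r.
Qed.

Definition hcoef n : R := (-1) ^+ n / Num.sqrt (2 ^+ n * n`!%:R * Num.sqrt pi).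

Lemma hermiteM m n x :
  hermite m x * hermite n x = poly_gauss ((hcoef m * hcoef n) *: (hpoly n * hpoly m)) x.
Proof.
rewrite /hermite !derive1n_gauss -/(hcoef m) -/(hcoef n) /poly_gauss hornerZ hornerM.
rewrite /gauss_fun.
have e1 : expR (x ^+ 2 / 2) * expR (x ^+ 2 / 2) * expR (- x ^+ 2) = 1.
  by rewrite -!expRD -splitr subrr expR0.
set e := expR (x ^+ 2 / 2) in e1 *; set g := expR (- x ^+ 2) in e1 *.
transitivity (hcoef m * hcoef n * ((hpoly n).[x] * (hpoly m).[x]) * g * (e * e * g)).
  by ring.
by rewrite e1 mulr1.
Qed.

Lemma hermite_orthonormal : orthonormal mu (@hermite R).
Proof.
split=> [n|].
  apply: Lfun2_sqr.
    rewrite /hermite; under eq_fun do rewrite derive1n_gauss.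
    apply: continuous_measurable_fun => x; apply: cvgM;
      last exact: continuous_poly_gauss.
    apply: cvgM; first exact: cvg_cst.
    apply: continuous_comp; last exact: continuous_expR.
    by apply: cvgM; [exact: exprn_continuous|exact: cvg_cst].
  rewrite (_ : (fun _ => _) = poly_gauss ((hcoef n * hcoef n) *: (hpoly n * hpoly n))).
    exact: integrable_poly_gauss.
  by apply/funext => x; rewrite expr2 hermiteM.
move=> m n; wlog mn : m n / (m <= n)%N.
  by move=> H; have [/H//|/ltnW/H] := leqP m n; rewrite eq_sym ipC.
rewrite /ip; under eq_Rintegral do rewrite hermiteM.
rewrite -/(gauss_int _) gauss_intZ gauss_int_hpoly//.
have [->|] := eqVneq m n; last by rewrite mulr0n mulr0.
rewrite mulr1n /hcoef; set d := _ * Num.sqrt pi.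
have d0 : 0 < d by rewrite !mulr_gt0 ?exprn_gt0 ?ltr0n ?fact_gt0 ?sqrtr_gt0 ?pi_gt0.
move: d d0 => d d0.
have ss : (-1) ^+ n * (-1) ^+ n = 1 :> R by rewrite -exprMn mulrNN mul1r expr1n.
have dd : Num.sqrt d * Num.sqrt d = d by rewrite -expr2 sqr_sqrtr// ltW.
by rewrite mulrACA ss mul1r -invfM dd mulVf// gt_eqF.
Qed.

End gaussian_weight.

(** * Mean value inequality for square sums *)

Section mean_value.
Context (R : realType).

(** With [d n] the [n]-th term on the left, the scalar mean value theorem for
    [\sum_n d n * (A n x - x * v n)] writes [\sum_n d n ^ 2] as
    [\sum_n d n * ((t - s) * (a n c - v n))] for some [c]; the inequality
    [x * y <= (x ^ 2 + y ^ 2) / 2] then absorbs half of it. *)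
Lemma sum_sqr_mean_value (A a : nat -> R -> R) (v : nat -> R) (N : nat) (s t M : R) :
  (forall (n : nat) (x : R), is_derive x 1 (A n) (a n x)) ->
  (forall x, `|x - s| <= `|t - s| -> \sum_(n < N) (a n x - v n) ^+ 2 <= M) ->
  \sum_(n < N) (A n t - A n s - (t - s) * v n) ^+ 2 <= (t - s) ^+ 2 * M.
Proof.
move=> dA aM; pose d n := A n t - A n s - (t - s) * v n.
pose F (x : R) := \sum_(n < N) d n * (A n x - x * v n).
pose F' (x : R) := \sum_(n < N) d n * (a n x - v n).
have dF (x : R) : is_derive x 1 F (F' x).
  rewrite /F /F'; elim: N {aM F F'} => [|N IH].
    under eq_fun do rewrite big_ord0.
    by rewrite big_ord0; exact: is_derive_cst.
  under eq_fun do rewrite big_ord_recr/=.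
  rewrite big_ord_recr/=; apply: is_deriveD.
  have /is_derive_eq := is_deriveZ (d N) (is_deriveB (dA N x)
    (is_deriveM (is_derive_id x (1 : R)) (is_derive_cst (v N) x (1 : R)))); apply.
  rewrite /GRing.scale /=; ring.
have cF : continuous F.
  move=> x; apply/differentiable_continuous/derivable1_diffP.
  by have [] := dF x.
have [c ct Fc] : exists2 c, `|c - s| <= `|t - s| & F t - F s = F' c * (t - s).
  have [st|ts] := leP s t.
    have [c cst ->] := MVT_segment st (fun x _ => dF x) (continuous_subspaceT cF).
    exists c => //; move: cst; rewrite in_itv/= => /andP[sc ct].
    by rewrite !ger0_norm ?subr_ge0// lerD2r.
  have [c cst Fc] := MVT_segment (ltW ts) (fun x _ => dF x) (continuous_subspaceT cF).
  exists c; last by rewrite -opprB Fc -mulrN opprB.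
  move: cst; rewrite in_itv/= => /andP[tc cs].
  have cs0 : c - s <= 0 by rewrite subr_le0.
  have ts0 : t - s <= 0 by rewrite subr_le0 ltW.
  by rewrite (ler0_norm cs0) (ler0_norm ts0) lerN2 lerD2r.
have FE : F t - F s = \sum_(n < N) d n ^+ 2.
  rewrite /F -sumrB; apply: eq_bigr => n _; rewrite -mulrBr expr2; congr (_ * _).
  rewrite /d; ring.
have le1 : \sum_(n < N) d n ^+ 2 <=
    \sum_(n < N) (d n ^+ 2 / 2 + (t - s) ^+ 2 / 2 * (a n c - v n) ^+ 2).
  rewrite -{1}FE Fc mulr_suml; apply: ler_sum => n _.
  by have := sqr_ge0 (d n - (t - s) * (a n c - v n)); nra.
have := aM c ct; have ts0 := sqr_ge0 (t - s).
move: le1; rewrite big_split/= -mulr_suml -mulr_sumr.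
set S := \sum_(n < N) d n ^+ 2; set S' := \sum_(n < N) _.
rewrite -/S => le1 le2; have := ler_wpM2l ts0 le2; lra.
Qed.

(** Starting the integrals from a point [c] below both [a] and [x] removes the case
    distinction on orientation near [x]. *)
Lemma is_derive_oriented_integral (f : R -> R) (a x : R) : continuous f ->
  is_derive x 1 (fun y => oriented_integral a y f) (f x).
Proof.
move=> cf.
pose c := Num.min a x - 1.
have ca : c < a by rewrite /c ltrBlDr (@le_lt_trans _ _ a)// ?ltrDl// ge_min lexx.
have cx : c < x by rewrite /c ltrBlDr (@le_lt_trans _ _ x)// ?ltrDl// ge_min lexx orbT.
pose F (y : R) := \int[lebesgue_measure]_(t in `[c, y]) f t.
have intf y z : lebesgue_measure.-integrable `[y, z] (EFin \o f).
  apply: continuous_compact_integrable; first exact: segment_compact.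
  exact: continuous_subspaceT.
have FE y : c < y -> oriented_integral a y f = F y - F a.
  move=> cy; rewrite /oriented_integral; case: leP => [ay|ya].
    rewrite /F Rintegral_itvB ?bnd_simp// ?ltW//.
    rewrite Rintegral_itv_obnd_cbnd//.
    by apply: integrableS (intf a y) => //; exact: subset_itv_oc_cc.
  rewrite -[RHS]opprB; congr (- _).
  rewrite /F Rintegral_itvB ?bnd_simp// ?ltW//.
  rewrite Rintegral_itv_obnd_cbnd//.
  by apply: integrableS (intf y a) => //; exact: subset_itv_oc_cc.
have x1 : x < x + 1 by rewrite ltrDl.
have [dF F'] := @continuous_FTC1_closed R f c x (x + 1) x1 (intf _ _) cx (cf x).
have dFa : is_derive x 1 (fun y => F y - F a) (f x).
  rewrite -(subr0 (f x)); apply: is_deriveB.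
  by split => //; rewrite -derive1E.
apply: near_eq_is_derive dFa; near=> y; rewrite FE//.
by near: y; apply: lt_nbhsr.
Unshelve. all: by end_near. Qed.

End mean_value.

(** * Coefficients of exponentials in L_2(sigma) *)

Section spectral_measure.
Context (R : realType) (sigma : probability (measurableTypeR R) R).
Implicit Types t y u : R.
Hypothesis sigma_sym : symmetric_measure sigma.

(** The kernel of the Hartley transform. As [sigma] is symmetric, the products
    [sin (y u) cos (z u)] integrate to [0], and [cas] has in real [L_2(sigma)] the
    same Gram matrix as the exponentials have in complex [L_2(sigma)]. *)
Definition cas (y u : R) : R := cos (y * u) + sin (y * u).

Lemma fourierRE t : fourierR sigma t = \int[sigma]_u cos (t * u).
Proof. by []. Qed.

Lemma integral_sin_eq0 t : \int[sigma]_u sin (t * u) = 0.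
Proof. by have := fourier_real t sigma_sym => -[]. Qed.

Lemma continuous_cosM t : continuous (fun u : R => cos (t * u)).
Proof.
move=> x; apply: continuous_comp; last exact: continuous_cos.
by apply: cvgM; [exact: cvg_cst|exact: cvg_id].
Qed.

Lemma continuous_sinM t : continuous (fun u : R => sin (t * u)).
Proof.
move=> x; apply: continuous_comp; last exact: continuous_sin.
by apply: cvgM; [exact: cvg_cst|exact: cvg_id].
Qed.

Lemma integrable_bounded_continuous (f : R -> R) (M : R) : continuous f ->
  (forall x, `|f x| <= M) -> sigma.-integrable setT (EFin \o f).
Proof.
move=> cf fM; apply: measurable_bounded_integrable => //.
- by rewrite (le_lt_trans (probability_le1 _ _))// ltry.
- exact: continuous_measurable_fun.
- exists M; split => [|N MN x _ /=]; first exact: num_real.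
  by rewrite (le_trans (fM x))// ltW.
Qed.

Lemma continuous_cas y : continuous (cas y).
Proof. by move=> x; apply: cvgD; [exact: continuous_cosM|exact: continuous_sinM]. Qed.

Lemma cas_Lfun2 y : cas y \in Lfun sigma 2%:E.
Proof.
apply: Lfun2_sqr.
  by apply: continuous_measurable_fun; exact: continuous_cas.
apply: (@integrable_bounded_continuous _ 4).
  by move=> x; apply: cvgM; exact: continuous_cas.
move=> x; rewrite normrX (_ : 4 = 2 ^+ 2); last by ring.
rewrite ler_pXn2r ?nnegrE ?normr_ge0//.
have := cos_max (y * x); have := sin_max (y * x).
by have := ler_normD (cos (y * x)) (sin (y * x)); rewrite /cas; lra.
Qed.

Lemma ip_cas y z : ip sigma (cas y) (cas z) = fourierR sigma (y - z).
Proof.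
transitivity (\int[sigma]_u (cos ((y - z) * u) + sin ((y + z) * u))).
  apply: eq_Rintegral => u _.
  rewrite /cas mulrBl [(y + z) * u]mulrDl cosB sinD; ring.
rewrite RintegralD ?integral_sin_eq0 ?addr0//.
- apply: (@integrable_bounded_continuous _ 1); first exact: continuous_cosM.
  by move=> u; exact: cos_max.
- apply: (@integrable_bounded_continuous _ 1); first exact: continuous_sinM.
  by move=> u; exact: sin_max.
Qed.

Lemma fourierR0 : fourierR sigma 0 = 1.
Proof.
rewrite fourierRE; under eq_Rintegral do rewrite mul0r cos0.
rewrite Rintegral_cst// mul1r; exact: (congr1 fine (probability_setT sigma)).
Qed.

Lemma normr_sin_le (x : R) : `|sin x| <= `|x|.
Proof.
have ds (y : R) : is_derive y 1 sin (cos y) by exact: is_derive_sin.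
have cs : continuous (@sin R) by exact: continuous_sin.
have [x0|x0] := leP 0 x.
  have [c _] := MVT_segment x0 (fun y _ => ds y) (continuous_subspaceT cs).
  rewrite sin0 !subr0 => ->; rewrite normrM ler_piMl//; exact: cos_max.
have [c _] := MVT_segment (ltW x0) (fun y _ => ds y) (continuous_subspaceT cs).
rewrite sin0 !sub0r => /eqP; rewrite eqr_oppLR => /eqP ->.
by rewrite normrN normrM normrN ler_piMl//; exact: cos_max.
Qed.

Lemma one_sub_cos_le (x : R) : 1 - cos x <= x ^+ 2 / 2.
Proof.
rewrite [in cos x](splitr x) cosD -!expr2 cos2sin2.
have := normr_sin_le (x / 2); rewrite -ler_sqr ?nnegrE// !real_normK ?num_real//.
by rewrite exprMn; set s := sin _; nra.
Qed.

Hypothesis sigma_supp : sigma (~` `[- 2^-1, 2^-1]) = 0%E.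

(** The left-hand side is [||e_(y + t) - e_y|| ^ 2]. *)
Lemma two_sub_fourierR_le_sqr t : 2 - 2 * fourierR sigma t <= t ^+ 2.
Proof.
suff : 1 - fourierR sigma t <= t ^+ 2 / 2 by lra.
have i1 : sigma.-integrable setT (EFin \o (cst 1 : R -> R)).
  by apply: (@integrable_bounded_continuous _ 1) => x; [exact: cvg_cst|rewrite normr1].
have ic : sigma.-integrable setT (EFin \o (fun u : R => cos (t * u))).
  apply: (@integrable_bounded_continuous _ 1); first exact: continuous_cosM.
  by move=> u; exact: cos_max.
have -> : 1 - fourierR sigma t = \int[sigma]_u (1 - cos (t * u)).
  by rewrite RintegralB// -fourierRE -[in LHS]fourierR0 fourierRE;
    under [in LHS]eq_Rintegral do rewrite mul0r cos0.
pose K : set (measurableTypeR R) := `[- 2^-1, 2^-1]%classic.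
have mK : measurable K by exact: measurable_itv.
have -> : \int[sigma]_u (1 - cos (t * u)) = \int[sigma]_(u in K) (1 - cos (t * u)).
  rewrite /Rintegral (negligible_integral (measurableC mK) measurableT)//.
    by rewrite setDE setCK setTI.
  by have := integrableB measurableT i1 ic.
apply: (@le_trans _ _ (\int[sigma]_(u in K) (t ^+ 2 / 2))).
  apply: le_Rintegral => //.
  - by have := integrableB measurableT i1 ic; apply: integrableS.
  - apply: (@integrableS _ _ _ sigma setT) => //.
    apply: (@integrable_bounded_continuous _ `|t ^+ 2 / 2|) => x //; exact: cvg_cst.
  move=> u; rewrite /K/= in_itv/= => /andP[u1 u2].
  rewrite (le_trans (one_sub_cos_le _))// exprMn ler_wpM2r// ler_piMr ?sqr_ge0//.
  nra.
rewrite Rintegral_cst// ler_piMr ?divr_ge0 ?sqr_ge0//.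
have fine_le1 (x : \bar R) : (0 <= x)%E -> (x <= 1)%E -> fine x <= 1 by case: x.
exact: (fine_le1 _ (measure_ge0 sigma K) (probability_le1 sigma mK)).
Qed.

Variable lambda : nat -> R.
Hypothesis lambda_basis :
  orthonormal_basis sigma (fun n u => cexpi (lambda n * u)).

Lemma cas_orthonormal : orthonormal sigma (fun n => cas (lambda n)).
Proof.
split=> [n|m n]; first exact: cas_Lfun2.
rewrite ip_cas fourierRE; have [_ /(_ m n) + _] := lambda_basis.
move=> /(congr1 (@complex.Re R)); rewrite /cdot /cintegral /=.
have -> : complex.Re ((m == n)%:R : R[i]) = (m == n)%:R by case: (m == n).
move=> <-; apply: eq_Rintegral => u _.
by rewrite mulrBl cosB mulrN opprK.
Qed.

Lemma sum_sqr_fourierR y N : \sum_(n < N) fourierR sigma (y - lambda n) ^+ 2 <= 1.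
Proof.
have := bessel N cas_orthonormal (cas_Lfun2 y).
by rewrite ip_cas subrr fourierR0; under eq_bigr do rewrite ip_cas.
Qed.

Lemma sum_sqr_fourierRB y t N :
  \sum_(n < N) (fourierR sigma (y - lambda n) - fourierR sigma (t - lambda n)) ^+ 2
  <= (y - t) ^+ 2.
Proof.
pose c (z : R) : measurableTypeR R -> R := cas z.
have lc z : c z \in Lfun sigma 2%:E by exact: cas_Lfun2.
have lN : (-1) *: c t \in Lfun sigma 2%:E by exact: Lfun2Z.
have lf : c y + (-1) *: c t \in Lfun sigma 2%:E by exact: Lfun2D.
have ipB z : ip sigma (c y + (-1) *: c t) (c z) =
    fourierR sigma (y - z) - fourierR sigma (t - z).
  by rewrite ipDl// ipZl// !ip_cas mulN1r.
have := bessel N cas_orthonormal lf; under eq_bigr do rewrite ipB.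
move=> /le_trans; apply; rewrite ipDl// ipZl//.
rewrite !(ipC _ _ (c y + _)) !ipB !subrr fourierR0.
have := two_sub_fourierR_le_sqr (y - t).
have -> : fourierR sigma (t - y) = fourierR sigma (y - t).
  by rewrite !fourierRE -opprB; apply: eq_Rintegral => u _; rewrite mulNr cosN.
lra.
Qed.

(** A single term is bounded by the sum in [sum_sqr_fourierRB]. *)
Lemma continuous_fourierRB n : continuous (fun y : R => fourierR sigma (y - lambda n)).
Proof.
move=> x; apply/cvgrPdist_le => e e0; near=> y.
have := sum_sqr_fourierRB x y n.+1; rewrite big_ord_recr/=.
set S := \sum_(_ < _) _; set z := _ - _ => le1.
have S0 : 0 <= S by apply: sumr_ge0 => i _; exact: sqr_ge0.
have : z ^+ 2 <= (x - y) ^+ 2 by lra.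
rewrite -[z ^+ 2]real_normK ?num_real// -[(x - y) ^+ 2]real_normK ?num_real//.
rewrite ler_sqr ?nnegrE ?normr_ge0// => /le_trans; apply.
near: y; have := @cvg_id _ (nbhs x); move=> /cvgrPdist_le; exact.
Unshelve. all: by end_near. Qed.

Lemma is_derive_Qcoef n t : is_derive t 1 (fun s => Qcoef sigma lambda s n)
  (fourierR sigma (t - lambda n)).
Proof.
exact: (is_derive_oriented_integral 0 t (continuous_fourierRB (n := n))).
Qed.

(** [sum_sqr_mean_value] for the coefficient curve compared with a constant, whose
    slope is [0]. *)
Lemma sum_sqr_QcoefB t s N :
  \sum_(n < N) (Qcoef sigma lambda t n - Qcoef sigma lambda s n) ^+ 2 <= (t - s) ^+ 2.
Proof.
have := @sum_sqr_mean_value R (fun n t => Qcoef sigma lambda t n)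
  (fun n t => fourierR sigma (t - lambda n)) (cst 0) N s t 1 is_derive_Qcoef.
under eq_bigr do rewrite /= mulr0 subr0.
rewrite mulr1; apply => x _; under eq_bigr do rewrite subr0.
exact: sum_sqr_fourierR.
Qed.

(** [sum_sqr_mean_value] for the coefficient curve compared with its tangent at
    [s]: the slopes at a point [x] between [s] and [t] differ by at most [|x - s|]. *)
Lemma sum_sqr_Qcoef_taylor t s N :
  \sum_(n < N) (Qcoef sigma lambda t n - Qcoef sigma lambda s n -
     (t - s) * fourierR sigma (s - lambda n)) ^+ 2 <= ((t - s) ^+ 2) ^+ 2.
Proof.
have := @sum_sqr_mean_value R (fun n t => Qcoef sigma lambda t n)
  (fun n t => fourierR sigma (t - lambda n)) (fun n => fourierR sigma (s - lambda n))
  N s t ((t - s) ^+ 2) is_derive_Qcoef.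
rewrite -expr2; apply => x xs; rewrite (le_trans (sum_sqr_fourierRB _ _ _))//.
rewrite -[(x - s) ^+ 2]real_normK ?num_real// -[(t - s) ^+ 2]real_normK ?num_real//.
by rewrite ler_sqr ?nnegrE ?normr_ge0.
Qed.

End spectral_measure.

(** * The process and its derivative *)

Section process.
Context (R : realType) (sigma : probability (measurableTypeR R) R).
Variables (lambda : nat -> R) (P : probability (Omega R) R).
Variable tilde : (R -> R) -> (Omega R -> R).
Hypothesis sigma_sym : symmetric_measure sigma.
Hypothesis sigma_supp : sigma (~` `[- 2^-1, 2^-1]) = 0%E.
Hypothesis lambda_basis :
  orthonormal_basis sigma (fun n u => cexpi (lambda n * u)).
Hypothesis tilde_isometry : white_noise_isometry P tilde.
Let mu := @lebesgue_measure R.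
Let h := @hermite R.
Let X := Xsigma sigma lambda tilde.
Let q := Qsigma1 sigma lambda.

Let lh k : h k \in Lfun mu 2%:E. Proof. by have [] := hermite_orthonormal R. Qed.

Lemma L2_cvg_Qsigma1 t :
  L2_cvg mu (partial_sum (fun n x => Qcoef sigma lambda t n * h n x)) (q t).
Proof.
have [|f qf] := @orthonormal_series_cvg _ _ _ mu h (Qcoef sigma lambda t) (t ^+ 2)
  (hermite_orthonormal R); last exact: L2_sumP qf.
move=> n; have := sum_sqr_QcoefB sigma_sym sigma_supp lambda_basis t 0 n.
have Q0 k : Qcoef sigma lambda 0 k = 0.
  by rewrite /Qcoef /oriented_integral lexx set_itv1 Rintegral_set1.
by rewrite subr0; under eq_bigr do rewrite Q0 subr0.
Qed.

Lemma Lfun_Qsigma1 t : q t \in Lfun mu 2%:E.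
Proof. by case: (L2_cvg_Qsigma1 t). Qed.

Lemma Xsigma_lipschitz t s : (L2norm P (X t \- X s)%R <= `|t - s|%:E)%E.
Proof.
have [tL tlin tnorm _] := tilde_isometry.
have -> : L2norm P (X t \- X s)%R = L2norm mu (q t - q s).
  exact: (L2norm_isoB tL tlin tnorm (Lfun_Qsigma1 t) (Lfun_Qsigma1 s)).
have := L2_cvg_linear (-1) (L2_cvg_Qsigma1 s) (L2_cvg_Qsigma1 t).
rewrite scaleN1r addrC => /L2_cvg_norm_le; apply => n.
rewrite !partial_sum_combo scaler_sumr -big_split/=.
under eq_bigr do rewrite scalerA -scalerDl.
pose b k := -1 * Qcoef sigma lambda s k + Qcoef sigma lambda t k.
apply: (@L2norm_combo_le _ _ _ mu h b) => //.
  exact: hermite_orthonormal.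
rewrite real_normK ?num_real// /b; under eq_bigr do rewrite mulN1r addrC.
exact: sum_sqr_QcoefB.
Qed.

(** The existence of an [L_2]-limit; the point of exhibiting it as [tilde g] is that
    [Xsigma_derive] can then compare [X] and [W] before applying [tilde]. *)
Lemma Wsigma_limit t : exists g,
  [/\ L2_cvg mu (partial_sum (fun n x => fourierR sigma (t - lambda n) * h n x)) g &
    L2_cvg P (partial_sum (Wterm sigma lambda tilde t)) (tilde g)].
Proof.
have [tL tlin tnorm _] := tilde_isometry.
pose a n := fourierR sigma (t - lambda n).
have [|g ag] := @orthonormal_series_cvg _ _ _ mu h a 1 (hermite_orthonormal R).
  by move=> n; exact: sum_sqr_fourierR.
exists g; split => //.
exact: (L2_cvg_iso tL tlin tnorm lh ag).
Qed.

(** Before applying [tilde], the difference quotient with step [e] minus the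
    derivative is [e^-1] times the Taylor remainder, of norm at most [e ^ 2]. *)
Lemma Xsigma_derive t : L2_is_derive P X t (Wsigma P sigma lambda tilde t).
Proof.
have [tL tlin tnorm _] := tilde_isometry.
have [g [ag tg]] := Wsigma_limit t.
have Wc := L2_sumP tg.
have lX s : X s \in Lfun P 2%:E by apply: tL; exact: Lfun_Qsigma1.
have lW : Wsigma P sigma lambda tilde t \in Lfun P 2%:E by case: Wc.
have lg : g \in Lfun mu 2%:E by case: ag.
split => //.
have bnd e : e != 0 -> (L2norm P (fun w => (e^-1 * (X (e + t) w - X t w)
    - Wsigma P sigma lambda tilde t w)%R) <= `|e|%:E)%E.
  move=> e0.
  have WE := L2_cvg_unique tg Wc.
  pose D := e^-1 *: (tilde (q (e + t)) - tilde (q t)) - tilde g.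
  have lD : D \in Lfun P 2%:E.
    by apply: Lfun2B; [apply: Lfun2Z; apply: Lfun2B; exact: lX|exact: tL].
  set D' := (fun w => _); have -> : D' = D + (tilde g - Wsigma P sigma lambda tilde t).
    by rewrite /D addrA subrK.
  rewrite (le_trans (L2normD lD (Lfun2B (tL _ lg) lW)))// WE adde0.
  rewrite (L2norm_iso_diff_quotient tL tlin tnorm e^-1 (Lfun_Qsigma1 _)
    (Lfun_Qsigma1 _) lg).
  have := L2_cvg_linear (- e) ag (L2_cvg_linear (-1) (L2_cvg_Qsigma1 t)
    (L2_cvg_Qsigma1 (e + t))).
  set f := (X in L2_cvg _ _ X) => fE.
  have lf : f \in Lfun mu 2%:E by case: fE.
  have -> : e^-1 *: (q (e + t) - q t) - g = e^-1 *: f.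
    rewrite /f [RHS]scalerDr scalerA mulrN mulVf// scaleN1r scaleN1r addrC.
    by rewrite [in RHS]addrC [in RHS](addrC (- q t)) addrC.
  rewrite L2normZ// normfV.
  have : (L2norm mu f <= (e ^+ 2)%:E)%E.
    apply: (L2_cvg_norm_le fE) => n.
    rewrite !partial_sum_combo !scaler_sumr -!big_split/=.
    under eq_bigr do rewrite !scalerA -!scalerDl.
    pose b k := - e * fourierR sigma (t - lambda k) +
      (-1 * Qcoef sigma lambda t k + Qcoef sigma lambda (e + t) k).
    apply: (@L2norm_combo_le _ _ _ mu h b);
      [exact: hermite_orthonormal|exact: sqr_ge0|].
    have := sum_sqr_Qcoef_taylor sigma_sym sigma_supp lambda_basis (e + t) t n.
    rewrite addrK => le1; apply: le_trans le1; apply: ler_sum => k _.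
    rewrite /b le_eqVlt; apply/orP; left; apply/eqP; ring.
  move=> fe; apply: (@le_trans _ _ (`|e|^-1%:E * (e ^+ 2)%:E)%E).
    by apply: lee_wpmul2l => //; rewrite lee_fin invr_ge0.
  by rewrite -EFinM lee_fin -(real_normK (num_real e)) expr2 mulrA mulVf ?mul1r//
    normr_eq0.
apply/cvge0P => [e|eps eps0]; first exact: Lnorm_ge0.
near=> e; rewrite (le_trans (bnd _ _))//.
  by near: e; exact: nbhs_dnbhs_neq.
by rewrite lee_fin; near: e; exact: dnbhs0_le.
Unshelve. all: by end_near. Qed.

End process.

Theorem theorem6p2 (R : realType)
    (sigma : probability (measurableTypeR R) R) (lambda : nat -> R)
    (P : probability (Omega R) R) (tilde : (R -> R) -> (Omega R -> R))
    (sigma_sym : symmetric_measure sigma)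
    (sigma_supp : sigma (~` `[- 2^-1, 2^-1]) = 0%E)
    (lambda0 : lambda 0%N = 0)
    (lambda_inj : injective lambda)
    (lambda_pi : forall n, exists k : nat, lambda n = pi * k%:R)
    (lambda_basis : orthonormal_basis sigma (fun n u => cexpi (lambda n * u)))
    (P_law : white_noise_law P)
    (tilde_isometry : white_noise_isometry P tilde) :
  (forall t s : R,
     (L2norm P (Xsigma sigma lambda tilde t \- Xsigma sigma lambda tilde s)%R
        <= `|t - s|%:E)%E) /\
  (forall t : R,
     L2_cvg P (partial_sum (Wterm sigma lambda tilde t))
       (Wsigma P sigma lambda tilde t) /\
     L2_is_derive P (Xsigma sigma lambda tilde) t (Wsigma P sigma lambda tilde t)).
Proof.
split=> [t s|t]; first exact: Xsigma_lipschitz.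
split; last exact: Xsigma_derive.
have [g [_ tg]] := Wsigma_limit sigma_sym lambda_basis tilde_isometry t.
exact: L2_sumP tg.
Qed.
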